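(* Let $P$ be a rooted poset with minimal element $x_0$ such that every element of $P$ is covered by finitely many elements, and let $G$ be the cover digraph of $P$ (an edge $x\to y$ whenever $y$ covers $x$), rooted at $x_0$. Then Blocker wins the prefix game on $P$ if and only if Devil wins the Angel-Devil game on $G$.
   Context: A poset is graded if all maximal chains between any two elements have the same length; a rooted poset is a graded poset with a unique minimal element (the root). A $k$-prefix is a chain $x_0,\dots,x_{k-1}$ with $x_0$ the root and $x_i$ covering $x_{i-1}$ for each $i\ge1$. In the $k$-prefix game on $P$, Walker and Blocker alternately (Walker first) choose previously unchosen elements of $P$; Walker wins if he chooses all elements of some $k$-prefix, and does so in the order $x_0,x_1,\dots,x_{k-1}$. Blocker wins the prefix game on $P$ if Blocker has a winning strategy in the $k$-prefix game for some $k$. The Angel-Devil game on an infinite rooted digraph $G$: vertices are initially unburned; Angel starts at the root; players alternate, Angel first; on each turn Angel moves from his current vertex to an unburned out-neighbor, and on each turn Devil burns at most one vertex (permanently). Devil wins if Angel is ever unable to move; Angel wins if he has a strategy to move forever.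
   Formalization: Angel's first turn is taken to be his placement at the root, so Devil may burn a vertex before Angel's first step; if Angel stepped before any burn the claim would fail for an infinite binary tree with an extra element below its root. *)

(* Defs.v *)
From mathcomp Require Import all_boot all_order.
From mathcomp Require Import boolp classical_sets functions cardinality.

Set Implicit Arguments.
Unset Strict Implicit.
Unset Printing Implicit Defensive.

Import Order.TTheory.
Local Open Scope classical_set_scope.
Local Open Scope order_scope.
Local Open Scope card_scope.

Section Posets.
Context {d : Order.disp_t} {P : porderType d}.
Implicit Types (x y z : P) (C D : set P).

(* [covby x y] reads "y covers x"; it is the edge relation x -> y of the cover
   digraph. *)
Definition covby x y : Prop := x < y /\ forall z, ~ (x < z /\ z < y).

Definition chain_between x y C : Prop :=
  C `<=` [set z | x <= z /\ z <= y] /\ total_on C <=%O.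

Definition maximal_chain_between x y C : Prop :=
  chain_between x y C /\ forall D, chain_between x y D -> C `<=` D -> D = C.

Definition minimal x : Prop := forall y, y <= x -> y = x.

End Posets.

(* "Same length" is equipotence, i.e. equality of the numbers of elements when
   the chains are finite; finiteness itself is not required. *)
Definition graded {d : Order.disp_t} (P : porderType d) : Prop :=
  forall (x y : P) (C D : set P),
    maximal_chain_between x y C -> maximal_chain_between x y D -> C #= D.

Definition rooted_poset {d : Order.disp_t} (P : porderType d) (x0 : P) : Prop :=
  graded P /\ [set x : P | minimal x] = [set x0].

Section PrefixGame.
Context {d : Order.disp_t} {P : porderType d}.
Variable x0 : P.
Implicit Types (h g s : seq P) (sigma : seq P -> P).

Definition k_prefix (k : nat) s : Prop :=
  [/\ size s = k, head x0 s = x0 &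
      forall i, (i.+1 < k)%N -> covby (nth x0 s i) (nth x0 s i.+1)].

(* A history [h] lists the moves of both players in the order they are made:
   Walker's are at positions 0, 2, 4, ... and Blocker's at positions
   1, 3, 5, ...  It is legal when it is duplicate-free. *)
Definition walker_moves h : seq P := mask (mkseq (fun i => ~~ odd i) (size h)) h.

(* Choosing the elements of [s] in the order of [s], possibly with other choices
   in between. *)
Definition walker_wins_at (k : nat) h : Prop :=
  exists2 s, k_prefix k s & subseq s (walker_moves h).

Definition blocker_follows sigma h : Prop :=
  forall g y, prefix (rcons g y) h -> odd (size g) -> y = sigma g.

(* Whenever it is Blocker's turn and some element is still unchosen, [sigma]
   names an unchosen one.  If every element has been chosen, no duplicate-free
   extension of the history exists and the game is over. *)
Definition blocker_legal sigma : Prop :=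
  forall h, uniq h -> blocker_follows sigma h -> odd (size h) ->
    (exists y, y \notin h) -> sigma h \notin h.

Definition blocker_winning_strategy (k : nat) sigma : Prop :=
  blocker_legal sigma /\
  forall h, uniq h -> blocker_follows sigma h -> ~ walker_wins_at k h.

Definition blocker_wins : Prop :=
  exists k, exists sigma, blocker_winning_strategy k sigma.

End PrefixGame.

Section AngelDevilGame.
Context {V : Type}.
Variables (E : V -> V -> Prop) (root : V).

(* Devil's strategy maps the list of Angel's positions so far to the vertex
   burned in reply, [None] meaning that nothing is burned; his own earlier burns
   are determined by it. *)
Implicit Types (delta : seq V -> option V) (p : nat -> V).

Definition burned delta p (n : nat) : set V :=
  [set v | exists2 i, (i <= n)%N & delta (mkseq p i.+1) = Some v].

(* Angel's opening turn puts him on the root [p 0], just as Walker opens by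
   choosing the least element of a prefix; Devil replies to [p n] before Angel
   moves to [p n.+1].  If Devil could only reply from [p 1] on, the two games
   would not be equivalent: on an infinite binary tree with one extra vertex
   below its root, Blocker answers that vertex with the root of the tree and
   wins, whereas Angel, once on the root of the tree, escapes forever. *)
Definition angel_escapes delta p : Prop :=
  p 0%N = root /\ forall n, E (p n) (p n.+1) /\ ~ burned delta p n (p n.+1).

(* Angel has to move whenever he can, so he gets stuck in every play against
   [delta] iff no infinite play against [delta] exists. *)
Definition devil_wins : Prop := exists delta, forall p, ~ angel_escapes delta p.

End AngelDevilGame.

(* Main.v *)
(** If Blocker wins, Devil copies Blocker's replies to the play in which Walker
    imitates Angel.  Conversely, since every vertex has finitely many
    out-neighbours, a winning Devil wins within a bounded number [N] of steps.
    Blocker treats every chosen element as burned and maintains that, whenever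
    Walker has completed a prefix of length [r], Devil wins in [N - r] steps
    against an Angel placed on any unchosen element extending it.  Walker's new
    element [y] is answered by the burn that wins fastest against an Angel on
    [y]; that one burn serves all the prefixes ending in [y], and the claims
    about other elements survive because extra burned elements only help Devil. *)
Require Import Defs.
From mathcomp Require Import all_boot all_order.
From mathcomp Require Import boolp classical_sets functions cardinality.

Set Implicit Arguments.
Unset Strict Implicit.
Unset Printing Implicit Defensive.

Import Order.TTheory.

Section BoundedDevil.
Context {d : Order.disp_t} {P : porderType d}.
Implicit Types (x y z b : P) (B : seq P).

(* Angel is on [x], the elements of [B] are burned, it is Devil's turn, and
   Angel gets stuck before making his [n]-th move. *)
Fixpoint devil_wins_in n x B : Prop :=
  if n is m.+1 then
    exists b, forall z, covby x z -> z \notin b :: B ->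
      devil_wins_in m z (b :: B)
  else False.

Lemma devil_wins_in_mono m n x B B' :
  m <= n -> {subset B <= B'} -> devil_wins_in m x B -> devil_wins_in n x B'.
Proof.
elim: m n x B B' => [|m IH] [|n] x B B' //= mn BB' [b Hb].
have sub : {subset b :: B <= b :: B'}.
  by move=> v; rewrite !inE => /predU1P[->|/BB' ->]; rewrite ?eqxx ?orbT.
exists b => z xz zB; apply: (IH _ _ (b :: B)) => //.
by apply: Hb => //; apply: contra zB; apply: sub.
Qed.

(** The burn for the least winning bound serves all larger bounds by monotonicity, so [b] need not
    depend on [m]. If no bound wins, any [b] will do. *)
Lemma fastest_burn x B : exists b, forall m, devil_wins_in m.+1 x B ->
  forall z, covby x z -> z \notin b :: B -> devil_wins_in m z (b :: B).
Proof.
have [ex|nex] := pselect (exists m, `[<devil_wins_in m.+1 x B>]); last first.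
  by exists x => m wm; case: nex; exists m; apply/asboolP.
case: (ex_minnP ex) => m /asboolP[b Hb] mmin; exists b => n wn z xz zB.
apply: devil_wins_in_mono (Hb z xz zB) => //.
by apply: mmin; apply/asboolP.
Qed.

Definition angel_safe x B := forall n, ~ devil_wins_in n x B.

Definition burn (o : option P) B := if o is Some b then b :: B else B.

Hypothesis hfin : forall x, finite_set (fun y => covby x y).

(** König's argument: if every available out-neighbour lost within some bound, the maximum of these
    finitely many bounds, plus one, would bound Devil's win from [x]. *)
Lemma angel_safe_step x B o : angel_safe x B ->
  exists y, [/\ covby x y, y \notin burn o B & angel_safe y (burn o B)].
Proof.
move=> safe; apply: contrapT => stuck.
have wins y : exists n, covby x y -> y \notin burn o B ->
    devil_wins_in n y (burn o B).
  have [[xy yB]|no] := pselect (covby x y /\ y \notin burn o B); last first.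
    by exists 0 => xy yB; case: no.
  apply: contrapT => nw; apply: stuck; exists y; split => // n wn.
  by apply: nw; exists n.
have [f Hf] := choice wins.
have /finite_seqP[s Hs] := hfin x.
(* [devil_wins_in] demands a burn; when [o] is [None], burning [x] instead cannot hurt Devil. *)
apply: (safe (\max_(y <- s) f y).+1); exists (odflt x o) => z xz zB.
have sub : {subset burn o B <= odflt x o :: B}.
  by case: (o) => [b|] v //=; rewrite inE => ->; rewrite orbT.
apply: (devil_wins_in_mono _ sub (Hf z xz _)); last first.
  by apply: contra zB; apply: sub.
apply: (@leq_bigmax_seq _ s predT f z) => //.
by have : [set` s]%classic z by rewrite -Hs.
Qed.

Lemma devil_wins_bounded x0 :
  devil_wins (@covby d P) x0 -> exists N, devil_wins_in N x0 [::].
Proof.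
case=> delta Hdelta; apply: contrapT => nw.
have safe0 : angel_safe x0 [::] by move=> n wn; apply: nw; exists n.
(* The existence claim becomes a premise so that [choice] yields a total function; [x0] is a dummy
   value. *)
have step (xB : P * seq P) : exists y,
    (exists y', [/\ covby xB.1 y', y' \notin xB.2 & angel_safe y' xB.2]) ->
    [/\ covby xB.1 y, y \notin xB.2 & angel_safe y xB.2].
  have [[y Hy]|no] := pselect (exists y',
    [/\ covby xB.1 y', y' \notin xB.2 & angel_safe y' xB.2]); first by exists y.
  by exists x0 => /no.
have [next Hnext] := choice step.
(* [run n] holds the positions [p 0] to [p n] and the burns replying to all of them but the last. *)
pose fix run n : seq P * seq P := if n is m.+1 then
    let: (t, B) := run m in let B' := burn (delta t) B in
    (rcons t (next (last x0 t, B')), B')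
  else ([:: x0], [::]).
pose p n := last x0 (run n).1.
have runS n :
    run n.+1 = (rcons (run n).1 (p n.+1), burn (delta (run n).1) (run n).2).
  by rewrite /p /=; case: (run n) => t B /=; rewrite last_rcons.
have pS n : p n.+1 = next (p n, (run n.+1).2).
  by rewrite /p /=; case: (run n) => t B /=; rewrite last_rcons.
have runE n : mkseq p n.+1 = (run n).1.
  elim: n => [|n IH]; first by [].
  by rewrite mkseqS IH [in RHS]runS.
have stepn n : angel_safe (p n) (run n).2 ->
    [/\ covby (p n) (p n.+1), p n.+1 \notin (run n.+1).2
      & angel_safe (p n.+1) (run n.+1).2].
  move=> safe; rewrite pS; apply: (Hnext (p n, (run n.+1).2)).
  by rewrite [run n.+1]runS; apply: angel_safe_step.
have safe n : angel_safe (p n) (run n).2 by elim: n => // n /stepn[].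
apply: (Hdelta p); split=> // n; have [pp /negP pB _] := stepn n (safe n).
split=> //.
(* Burns accumulate along [run]; fixing the vertex as [v] lets the induction vary only the time. *)
case=> i le_in; rewrite runE => Hi; apply: pB; move: (p n.+1) Hi => v Hi.
elim: n {pp} le_in => [|n IH].
  by rewrite leqn0 => /eqP i0; rewrite runS -i0 Hi mem_head.
rewrite leq_eqVlt ltnS => /predU1P[iE|/IH vB].
  by rewrite runS -iE Hi mem_head.
by rewrite runS /burn; case: (delta _) => // b; rewrite inE vB orbT.
Qed.

End BoundedDevil.

Section Prefixes.
Context {d : Order.disp_t} {P : porderType d}.
Variable x0 : P.
Implicit Types (x y : P) (h s : seq P).

Lemma k_prefix_rcons k s y : k_prefix x0 k.+1 (rcons s y) -> k_prefix x0 k s.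
Proof.
case=> /eqP; rewrite size_rcons eqSS => /eqP sk hd cov; split=> //.
  by case: s hd {sk cov}.
move=> i ik; have := cov i (ltnW ik).
by rewrite !nth_rcons sk ik (ltnW ik).
Qed.

Lemma k_prefix_covby k s x y : k_prefix x0 k (rcons (rcons s x) y) -> covby x y.
Proof.
case=> <- _ /(_ (size s)); rewrite !size_rcons ltnSn => /(_ isT).
by rewrite !nth_rcons !size_rcons ltnSn !ltnn !eqxx.
Qed.

Lemma walker_moves_rcons h y : walker_moves (rcons h y) =
  if odd (size h) then walker_moves h else rcons (walker_moves h) y.
Proof.
rewrite /walker_moves size_rcons mkseqS mask_rcons ?size_mkseq //.
by case: (odd _) => /=; rewrite ?cats0 ?cats1.
Qed.

Lemma subseq_rconsr s h y : subseq s (rcons h y) ->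
  subseq s h \/ exists2 s', s = rcons s' y & subseq s' h.
Proof.
rewrite -subseq_rev rev_rcons; case/lastP: s => [|s z].
  by left; rewrite sub0seq.
rewrite rev_rcons /=; case: eqVneq => [-> | _] sub; last first.
  by left; rewrite -subseq_rev rev_rcons.
by right; exists s => //; rewrite -subseq_rev.
Qed.

Lemma blocker_follows_rcons sigma h y :
  blocker_follows sigma (rcons h y) -> blocker_follows sigma h.
Proof.
move=> fol g z gh; apply: fol; apply: prefix_trans gh _; exact: prefix_rcons.
Qed.

Lemma follows_rcons sigma h y : blocker_follows sigma h ->
  (odd (size h) -> y = sigma h) -> blocker_follows sigma (rcons h y).
Proof.
move=> fol yE g z /prefixP[t]; case/lastP: t => [|t w].
  by rewrite cats0 => /rcons_inj[<- <-].
rewrite -rcons_cat => /rcons_inj[hE _]; apply: fol.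
by rewrite hE prefix_prefix.
Qed.

Lemma blocker_strategy : exists sigma : seq P -> P, forall h,
  ((exists y, y \notin h) -> sigma h \notin h) /\
  forall m, devil_wins_in m.+1 (last x0 h) h -> forall z, covby (last x0 h) z ->
    z \notin rcons h (sigma h) -> devil_wins_in m z (rcons h (sigma h)).
Proof.
suff /choice[sigma] : forall h, exists b,
  ((exists y, y \notin h) -> b \notin h) /\
  forall m, devil_wins_in m.+1 (last x0 h) h -> forall z, covby (last x0 h) z ->
    z \notin rcons h b -> devil_wins_in m z (rcons h b) by exists sigma.
move=> h; have [b Hb] := fastest_burn (last x0 h) h.
have rE c : rcons h c =i c :: h by move=> v; rewrite mem_rcons.
have [bh|bh] := boolP (b \in h); last first.
  exists b; split=> // m wm z xz; rewrite rE => zh.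
  by apply: devil_wins_in_mono (Hb m wm z xz zh) => // v; rewrite rE.
(* Blocker may not repeat the chosen element [b], but burning it again would change nothing, so any
   unchosen [c] does as well. *)
have [c Hc] : exists c, (exists y, y \notin h) -> c \notin h.
  have [[c ch]|no] := pselect (exists y, y \notin h); first by exists c.
  by exists b => /no.
exists c; split=> // m wm z xz; rewrite rE inE negb_or => /andP[_ zh].
have zb : z \notin b :: h.
  by rewrite inE negb_or zh andbT; apply: contraNneq zh => ->.
apply: devil_wins_in_mono (Hb m wm z xz zb) => // v; rewrite rE !inE.
by case/predU1P=> [->|->]; rewrite ?bh orbT.
Qed.

Lemma bounded_blocker_wins N : devil_wins_in N x0 [::] -> blocker_wins x0.
Proof.
move=> win0; have [sigma Hsigma] := blocker_strategy.
exists N.+1, sigma; split=> [h _ _ _ /(proj1 (Hsigma h))//|h].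
(* Here [k] is the length of the completed prefix [s]. The second alternative covers the half-turn
   in which [s] ends in Walker's latest element, still unanswered: Devil is then to move against an
   Angel on that element. *)
suff inv : uniq h -> blocker_follows sigma h ->
    (forall k s, k_prefix x0 k s -> subseq s (walker_moves h) -> k <= N) /\
    (forall k s z, k_prefix x0 k.+1 (rcons s z) ->
       subseq s (walker_moves h) -> z \notin h ->
       devil_wins_in (N - k) z h \/
       [/\ odd (size h), covby (last x0 h) z
         & devil_wins_in (N - k).+1 (last x0 h) h]).
  by move=> uh fh [s /(proj1 (inv uh fh)) + /[dup] _]; rewrite ltnn => /[apply].
elim/last_ind: h => [|h y IH] uh fh.
  split=> [k s [<- _ _]|k s z]; first by rewrite subseq0 => /eqP->.
  move=> + + _; rewrite subseq0 => + /eqP sE; rewrite {}sE => -[[<-] /= -> _].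
  by left; rewrite subn0.
move: uh; rewrite rcons_uniq => /andP[yh uh].
have [short inv] := IH uh (blocker_follows_rcons fh).
have hsub : {subset h <= rcons h y}.
  by move=> v vh; rewrite mem_rcons inE vh orbT.
rewrite walker_moves_rcons size_rcons last_rcons oddS.
case: ifP => odd_h; split.
- exact: short.
- move=> k s z ps sub zh; left.
  have zh' : z \notin h by apply: contra zh; apply: hsub.
  have [w|[_ lz w]] := inv k s z ps sub zh'; first exact: devil_wins_in_mono w.
  rewrite (fh h y (prefix_refl _) odd_h) in zh *.
  exact: (proj2 (Hsigma h)).
(* A prefix completed by [y] had a winning bound at [y]; that bound is positive since
   [devil_wins_in 0] is false, so the new length is still at most [N]. *)
- move=> k s ps /subseq_rconsr[|[s' sE] sub]; first exact: short.
  rewrite sE in ps; case: k ps => // k ps.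
  have [w|[]//] := inv _ _ _ ps sub yh; last by rewrite odd_h.
  by rewrite -subn_gt0; case: (N - k) w.
- move=> k s z ps + zh; have zh' : z \notin h by apply: contra zh; apply: hsub.
  case/subseq_rconsr=> [sub|[s' sE sub]].
    have [w|[]//] := inv k s z ps sub zh'; last by rewrite odd_h.
    by left; apply: devil_wins_in_mono w.
  right; rewrite sE in ps; have cov := k_prefix_covby ps.
  case: k ps => [|k] ps; first by case: ps; rewrite !size_rcons.
  have [w|[]//] := inv k s' y (k_prefix_rcons ps) sub yh; last by rewrite odd_h.
  split=> //; apply: devil_wins_in_mono w => //.
  by rewrite subnS; case: (N - k).
Qed.

Lemma covby_path_lt (p : nat -> P) (pE : forall n, covby (p n) (p n.+1)) i j :
  i < j -> (p i < p j)%O.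
Proof. by apply: (homo_ltn lt_trans) => n; case: (pE n). Qed.

Lemma blocker_wins_devil_wins : blocker_wins x0 -> devil_wins (@covby d P) x0.
Proof.
case=> k [sigma [legal win]].
pose reply h := rcons h (sigma h).
(* The history in which Walker plays Angel's positions and [sigma] answers each; its last entry is
   what Devil burns. *)
pose play := foldl (fun h x => reply (rcons h x)) [::].
exists (fun t => Some (last x0 (play t))) => p [p0 esc].
have cov n : covby (p n) (p n.+1) := proj1 (esc n).
pose H n := play (mkseq p n).
have HS n : H n.+1 = reply (rcons (H n) (p n)).
  by rewrite /H mkseqS /play foldl_rcons.
(* The last clause keeps Walker's imitation legal: later positions lie strictly above earlier ones
   and differ from Blocker's replies, which are burned. *)
have inv n : [/\ ~~ odd (size (H n)), walker_moves (H n) = mkseq p n, uniq (H n),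
    blocker_follows sigma (H n) & forall m, n <= m -> p m \notin H n].
  elim: n => [|n [evn wH uH fH avoid]].
    by split=> // -[|? ?] y.
  have uHp : uniq (rcons (H n) (p n)) by rewrite rcons_uniq avoid.
  have odd_p : odd (size (rcons (H n) (p n))) by rewrite size_rcons.
  have fHp : blocker_follows sigma (rcons (H n) (p n)).
    by apply: follows_rcons => //; rewrite (negbTE evn).
  have avoidp m : n < m -> p m \notin rcons (H n) (p n).
    move=> nm; rewrite mem_rcons inE negb_or avoid ?(ltnW nm) // andbT.
    by rewrite gt_eqF // covby_path_lt.
  rewrite HS /reply; split.
  - by rewrite size_rcons /= odd_p.
  - by rewrite !walker_moves_rcons odd_p (negbTE evn) wH mkseqS.
  (* Angel's next position witnesses that Blocker still has an element to choose. *)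
  - by rewrite rcons_uniq uHp andbT legal //; exists (p n.+1); apply: avoidp.
  - exact: follows_rcons.
  - move=> [|m] // nm; rewrite mem_rcons inE negb_or avoidp // andbT.
    apply/eqP => pE; case: (esc m) => _; apply; exists n => //.
    by rewrite -/(H n.+1) HS /reply last_rcons pE.
have [_ wH uH fH _] := inv k; apply: (win _ uH fH).
exists (mkseq p k); last by rewrite wH.
split; first by rewrite size_mkseq.
  by case: (k) => //= j.
by move=> i ik; rewrite !nth_mkseq // ltnW.
Qed.

End Prefixes.

Theorem theorem7 (d : Order.disp_t) (P : porderType d) (x0 : P)
    (hP : rooted_poset x0)
    (hfin : forall x : P, finite_set (fun y : P => covby x y)) :
  blocker_wins x0 <-> devil_wins (@covby d P) x0.
Proof.
split; first exact: blocker_wins_devil_wins.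
by move=> /(devil_wins_bounded hfin)[N]; apply: bounded_blocker_wins.
Qed.
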